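(* Let $X$ and $Y$ be two real Banach spaces with property (CS). Then the projective tensor product $X\widehat{\otimes}_\pi Y$ also satisfies (CS).
   Context: All Banach spaces are real. $B_X$ and $S_X$ denote the closed unit ball and the unit sphere of $X$, and $X^*$ is the topological dual. A slice of $B_X$ is a set $S(B_X,f,\alpha):=\{x\in B_X: f(x)>1-\alpha\}$ with $f\in S_{X^*}$ and $\alpha>0$. A convex combination of slices of $B_X$ is a set $\sum_{i=1}^n\lambda_i S_i$ (Minkowski sum), where $\lambda_1,\dots,\lambda_n\in[0,1]$, $\sum_{i=1}^n\lambda_i=1$, and each $S_i$ is a slice of $B_X$. A Banach space $X$ has property (CS) if every convex combination of slices of $B_X$ intersects $S_X$. $X\widehat{\otimes}_\pi Y$ is the completed projective tensor product of $X$ and $Y$. *)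

(* Defs.v *)
From HB Require Import structures.
From mathcomp Require Import all_boot all_order all_algebra.
From mathcomp Require Import all_classical all_reals topology normedtype.

Set Implicit Arguments.
Unset Strict Implicit.
Unset Printing Implicit Defensive.

Import Order.TTheory GRing.Theory Num.Theory.
Import numFieldNormedType.Exports.

Local Open Scope classical_set_scope.
Local Open Scope ring_scope.

Section PropertyCS.
Context {R : realType} {X : normedModType R}.

Definition unit_ball : set X := [set x | `|x| <= 1].

Definition unit_sphere : set X := [set x | `|x| = 1].

(* The supremum is taken in R, so this is the operator norm only when [f] is
   continuous; [dual_sphere] asks for continuity separately. *)
Definition dual_norm (f : {scalar X}) : R := sup [set `|f x| | x in unit_ball].

Definition dual_sphere : set {scalar X} :=
  [set f : {scalar X} | continuous (f : X -> R) /\ dual_norm f = 1].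

Definition slice (f : {scalar X}) (alpha : R) : set X :=
  [set x | unit_ball x /\ f x > 1 - alpha].

Definition is_slice (S : set X) : Prop :=
  exists (f : {scalar X}) (alpha : R),
    [/\ dual_sphere f, 0 < alpha & S = slice f alpha].

Definition minkowski_comb (n : nat) (lam : 'I_n -> R) (S : 'I_n -> set X) :
    set X :=
  [set z | exists x : 'I_n -> X,
     (forall i, S i (x i)) /\ z = \sum_(i < n) lam i *: x i].

Definition convex_comb_of_slices (C : set X) : Prop :=
  exists (n : nat) (lam : 'I_n -> R) (S : 'I_n -> set X),
    [/\ forall i, 0 <= lam i <= 1,
        \sum_(i < n) lam i = 1,
        forall i, is_slice (S i) &
        C = minkowski_comb lam S].

End PropertyCS.

Definition propertyCS (R : realType) (X : normedModType R) : Prop :=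
  forall C : set X, convex_comb_of_slices C -> C `&` unit_sphere !=set0.

Section ProjectiveTensorProduct.
Context {R : realType} {X Y : normedModType R}.

(* [T], with [tens x y] in the role of the elementary tensor of x and y, is the
   algebraic tensor product of X and Y. *)
Definition is_tensor_product (T : lmodType R)
    (tens : {bilinear X -> Y -> T}) : Prop :=
  forall (W : lmodType R) (b : {bilinear X -> Y -> W}),
    (exists g : {linear T -> W}, forall x y, g (tens x y) = b x y) /\
    (forall g h : {linear T -> W},
       (forall x y, g (tens x y) = b x y) ->
       (forall x y, h (tens x y) = b x y) -> g =1 h).

Definition projective_norm (T : lmodType R) (tens : {bilinear X -> Y -> T})
    (u : T) : R :=
  inf [set r | exists (n : nat) (x : 'I_n -> X) (y : 'I_n -> Y),
         u = \sum_(i < n) tens (x i) (y i) /\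
         r = \sum_(i < n) `|x i| * `|y i|].

Definition is_completion (T : lmodType R) (p : T -> R)
    (Z : completeNormedModType R) (j : {linear T -> Z}) : Prop :=
  (forall u, `|j u| = p u) /\ dense (range j).

End ProjectiveTensorProduct.

(* The completed projective tensor product is determined up to a linear
   isometric isomorphism; this holds of every Banach space [Z] realising it. *)
Definition is_projective_tensor_product (R : realType) (X Y : normedModType R)
    (Z : completeNormedModType R) : Prop :=
  exists (T : lmodType R) (tens : {bilinear X -> Y -> T}) (j : {linear T -> Z}),
    is_tensor_product tens /\ is_completion (projective_norm tens) j.

(* Main.v *)
Require Import Defs.
From HB Require Import structures.
From mathcomp Require Import all_boot all_order all_algebra.
From mathcomp Require Import all_classical all_reals topology normedtype.
From mathcomp Require Import lra.

Set Implicit Arguments.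
Unset Strict Implicit.
Unset Printing Implicit Defensive.

Import Order.TTheory GRing.Theory Num.Theory.
Import numFieldNormedType.Exports.

Local Open Scope classical_set_scope.
Local Open Scope ring_scope.

(** Consider a convex combination, with weights [lam i], of slices cut out of
the unit ball of the projective tensor product by norm-one functionals [G i],
which are the same thing as norm-one bilinear forms on [X * Y].  The unit ball
of the projective norm is the closed convex hull of the elementary tensors
[tens x y] with [x] and [y] in the unit balls, so each slice contains some
[tens (u i) (v i)] ([elementary_tensor_in_slice]).

Freeze the second factor: the functional that sends [x] to [G i] at
[tens x (v i)] defines a slice of the ball of [X] that contains [u i].  Property
(CS) of [X] moves the points [u i] inside these slices to points [x i] whose
weighted mean has norm one ([propertyCS_open_halfspaces]).  Now freeze [x i] and
do the same in [Y], replacing [v i] by [y i].  All the [tens (x i) (y i)] still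
lie in the given slices.

It remains to see that the weighted mean of these tensors has norm one
([norm_convex_tens_eq1]).  By Hahn-Banach some [f] of norm one takes the value
[1] at the mean of the [x i].  As [f] is at most [1] on the ball, it must be
[1] at every [x i] of nonzero weight.  A functional [g] behaves likewise on the
[y i], so the tensor product of [f] and [g], which is dominated by the
projective norm, takes the value [1] at the mean of the [tens (x i) (y i)].

Hahn-Banach is obtained from the fact that a minimal sublinear functional is
linear: Zorn's lemma then applies directly to sublinear functionals, and no
partially defined functional is ever extended. *)

(** * The Hahn-Banach theorem *)

Section HahnBanach.
Context {R : realType} {V : lmodType R}.

Definition sublinear (q : V -> R) : Prop :=
  (forall x y, q (x + y) <= q x + q y) /\
  (forall a x, 0 < a -> q (a *: x) <= a * q x).

Lemma sublinear0 q : sublinear q -> q 0 = 0.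
Proof.
move=> [qD qZ]; have := qD 0 0; have := @qZ 2^-1 0 ltac:(lra).
rewrite scaler0 addr0; lra.
Qed.

Lemma sublinearZ q a x : sublinear q -> 0 <= a -> q (a *: x) = a * q x.
Proof.
move=> sq; rewrite le_eqVlt => /predU1P[<-|a0].
  by rewrite scale0r mul0r sublinear0.
apply/eqP; rewrite eq_le sq.2//= -ler_pdivlMl//.
rewrite -{1}(scale1r x) -(mulVf (lt0r_neq0 a0)) -scalerA sq.2// invr_gt0//.
Qed.

Lemma sublinearN_ge q x : sublinear q -> - q (- x) <= q x.
Proof.
by move=> sq; rewrite lerNl -subr_ge0 opprK addrC -(sublinear0 sq)
  -(subrr x) sq.1.
Qed.

(** The largest sublinear functional below [q] whose value at [- y] is the least
possible one, [- q y] (see [slideN]).  It serves twice, to show that minimal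
sublinear functionals are linear and to start from a functional that forces the
value at a prescribed vector. *)
Definition slide (q : V -> R) (y x : V) : R :=
  inf [set q (x + t *: y) - t * q y | t in [set t | 0 <= t]].

Lemma slide_has_lbound q y x : sublinear q ->
  has_lbound [set q (x + t *: y) - t * q y | t in [set t | 0 <= t]].
Proof.
move=> sq; exists (- q (- x)) => _ [t /= t0 <-].
rewrite -(sublinearZ y sq t0) lerBrDr addrC lerBlDr.
by rewrite -{1}(addKr x (t *: y)) addrC sq.1.
Qed.

Lemma slide_le q y x t : sublinear q -> 0 <= t ->
  slide q y x <= q (x + t *: y) - t * q y.
Proof. by move=> sq t0; apply: (ge_inf (slide_has_lbound y x sq)); exists t. Qed.

Lemma le_slide q y x b :
  (forall t, 0 <= t -> b <= q (x + t *: y) - t * q y) -> b <= slide q y x.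
Proof.
move=> bq; apply: lb_le_inf.
  by exists (q (x + 0 *: y) - 0 * q y), 0 => /=.
by move=> _ [t t0 <-]; exact: bq.
Qed.

Lemma slide_sublinear q y : sublinear q -> sublinear (slide q y).
Proof.
move=> sq; split=> [x x'|a x a0].
  rewrite -lerBlDr; apply: le_slide => t t0.
  rewrite lerBlDr -lerBlDl; apply: le_slide => s s0.
  rewrite lerBlDl (le_trans (@slide_le q y _ (t + s) sq _)) ?addr_ge0//.
  have := sq.1 (x + t *: y) (x' + s *: y).
  rewrite scalerDl addrACA; lra.
rewrite -ler_pdivrMl//; apply: le_slide => t t0.
rewrite ler_pdivrMl//.
rewrite (le_trans (@slide_le q y _ (a * t) sq _)) ?mulr_ge0 ?(ltW a0)//.
by rewrite -scalerA -scalerDr sublinearZ ?(ltW a0)// mulrBr mulrA.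
Qed.

Lemma slide_le_self q y x : sublinear q -> slide q y x <= q x.
Proof.
move=> sq; apply: le_trans (@slide_le q y x 0 sq _) _ => //.
by rewrite scale0r addr0 mul0r subr0.
Qed.

Lemma slideN q y : sublinear q -> slide q y (- y) <= - q y.
Proof.
move=> sq; apply: le_trans (@slide_le q y (- y) 1 sq ler01) _.
by rewrite scale1r addNr sublinear0// mul1r sub0r.
Qed.

(** Subadditivity of the infimum uses that the family is a chain: for members
[q] and [r], the smaller one bounds the infimum at [x + y] by [q y + r x]. The
infimum is finite because [q x >= - q (- x) >= - p (- x)]. *)
Lemma sublinear_inf_chain (p : V -> R) (A : set (V -> R)) :
  sublinear p -> A !=set0 ->
  (forall q, A q -> sublinear q /\ forall x, q x <= p x) ->
  (forall q r, A q -> A r ->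
     (forall x, q x <= r x) \/ (forall x, r x <= q x)) ->
  exists2 m : V -> R, sublinear m & forall q x, A q -> m x <= q x.
Proof.
move=> sp [q0 Aq0] AP Atot; pose E x := [set q x | q in A].
have lbE x : has_lbound (E x).
  exists (- p (- x)) => _ [q Aq <-]; have [sq qp] := AP _ Aq.
  by apply: le_trans (sublinearN_ge x sq); rewrite lerN2.
have mle q x : A q -> inf (E x) <= q x.
  by move=> Aq; apply: ge_inf => //; exists q.
have leE b x : (forall q, A q -> b <= q x) -> b <= inf (E x).
  move=> bq; apply: lb_le_inf; first by exists (q0 x), q0.
  by move=> _ [q Aq <-]; exact: bq.
exists (fun x => inf (E x)) => //; split=> [x y|a x a0] /=.
  rewrite -lerBlDl; apply: (leE _) => q Aq.
  rewrite lerBlDr -lerBlDl; apply: (leE _) => r Ar.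
  rewrite lerBlDl.
  have [qr|rq] := Atot _ _ Aq Ar.
    apply: le_trans (mle _ _ Aq) _; apply: le_trans ((AP _ Aq).1.1 _ _) _.
    by rewrite addrC lerD2l.
  apply: le_trans (mle _ _ Ar) _; apply: le_trans ((AP _ Ar).1.1 _ _) _.
  by rewrite addrC lerD2r.
rewrite -ler_pdivrMl//; apply: (leE _) => q Aq; rewrite ler_pdivrMl//.
by apply: le_trans (mle _ _ Aq) _; exact: (AP _ Aq).1.2.
Qed.

Lemma sublinear_minimal (p : V -> R) : sublinear p ->
  exists q, [/\ sublinear q, forall x, q x <= p x &
    forall r, sublinear r -> (forall x, r x <= q x) -> r =1 q].
Proof.
move=> sp; pose T := {q : V -> R | sublinear q /\ forall x, q x <= p x}.
pose le (s t : T) := `[< forall x, sval t x <= sval s x >].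
have [|||A Atot|[q [sq qp]] qmin] := @ZL_preorder T _ le.
- exact: (exist _ p (conj sp (fun x => lexx (p x)))).
- by move=> t; apply/asboolP.
- move=> r s t /asboolP rs /asboolP st; apply/asboolP => x.
  exact: le_trans (st x) (rs x).
- have [->|/set0P[t At]] := eqVneq A set0.
    by exists (exist _ p (conj sp (fun x => lexx (p x)))) => s.
  have [||q r|m sm mle] := @sublinear_inf_chain p [set sval s | s in A] sp.
  + by exists (sval t), t.
  + by move=> _ [s As <-]; exact: svalP s.
  + by move=> [s As <-] [s' As' <-];
      have [/asboolP|/asboolP] := Atot _ _ As As'; [right|left].
  have mp x : m x <= p x.
    by apply: le_trans (mle _ _ _) ((svalP t).2 x); exists t.
  exists (exist _ m (conj sm mp)) => s As; apply/asboolP => x /=.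
  by apply: mle; exists s.
exists q; split=> // r sr rq x.
have rp z : r z <= p z by exact: le_trans (rq z) (qp z).
have := qmin (exist _ r (conj sr rp)) (asboolT rq).
by move=> /asboolP/= qr; apply/eqP; rewrite eq_le rq qr.
Qed.

Lemma scalar_map (f : V -> R) : scalar f -> exists g : {scalar V}, g =1 f.
Proof.
move=> lf; pose fL := GRing.isLinear.Build R V R *%R f lf.
pose g : {scalar V} := HB.pack f fL.
by exists g.
Qed.

(** A minimal sublinear functional [q] coincides with each [slide q y], and the
bound [q x = slide q y x <= q (x + y) - q y] is the missing half of
additivity. *)
Lemma hahn_banach (p : V -> R) : sublinear p ->
  exists f : {scalar V}, forall x, f x <= p x.
Proof.
move=> sp; have [q [sq qp qmin]] := sublinear_minimal sp.
have slideE x y : slide q y x = q x.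
  by apply: qmin; [exact: slide_sublinear|move=> z; exact: slide_le_self].
have qN y : q (- y) = - q y.
  apply/eqP; rewrite eq_le -{1}(slideE _ y) slideN//= lerNl.
  by have := sublinearN_ge (- y) sq; rewrite opprK lerNl.
have qD x y : q (x + y) = q x + q y.
  apply/eqP; rewrite eq_le sq.1 -lerBrDr -{1}(slideE x y).
  by have := @slide_le q y x 1 sq ler01; rewrite scale1r mul1r.
have qZ a x : q (a *: x) = a * q x.
  have [a0|/ltW a0] := leP 0 a; first exact: sublinearZ.
  by apply: oppr_inj; rewrite -qN -scaleNr -mulNr sublinearZ ?oppr_ge0.
have [f fq] : exists f : {scalar V}, f =1 q.
  by apply: scalar_map => a x y; rewrite qD qZ.
by exists f => x; rewrite fq.
Qed.

End HahnBanach.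

(** * Functionals on a normed space and slices *)

Section NormedDual.
Context {R : realType} {V : normedModType R}.
Implicit Type f : {scalar V}.

(** A functional below [slide p x0], with [p] the norm, is below the norm, and
its value at [- x0] is at most [- p x0]. *)
Lemma norming_functional (x0 : V) :
  exists f, (forall x, `|f x| <= `|x|) /\ f x0 = `|x0|.
Proof.
pose p (x : V) : R := `|x|.
have sp : sublinear p.
  by split=> [x y|a x a0]; rewrite /p ?ler_normD// normrZ gtr0_norm.
have [f fp] := hahn_banach (slide_sublinear x0 sp).
have fle x : f x <= `|x| by exact: le_trans (fp x) (slide_le_self _ _ sp).
exists f; split=> [x|].
  by rewrite ler_norml fle andbT lerNl -raddfN -normrN fle.
apply/eqP; rewrite eq_le fle/= -lerN2 -raddfN.
exact: le_trans (fp _) (slideN x0 sp).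
Qed.

Lemma scalar_bounded_continuous f M :
  (forall x, `|f x| <= M * `|x|) -> continuous (f : V -> R).
Proof.
move=> fM; apply: (@bounded_linear_continuous R V R^o f).
apply/linear_boundedP; near=> r => x.
apply: le_trans (fM x) _; apply: ler_wpM2r => //; near: r.
exact: nbhs_pinfty_ge (num_real M).
Unshelve. all: by end_near. Qed.

Lemma dual_norm_le f c :
  (forall x, unit_ball x -> `|f x| <= c) -> dual_norm f <= c.
Proof.
move=> fc; apply: ge_sup => [|_ [x x1 <-]]; last exact: fc.
by exists `|f 0|, 0 => //=; rewrite /unit_ball/= normr0.
Qed.

Lemma dual_norm_ge f x : continuous (f : V -> R) -> unit_ball x ->
  `|f x| <= dual_norm f.
Proof.
move=> /((@linear_bounded_continuous R V R^o f).2).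
rewrite linear_boundedP => /pinfty_ex_gt0[r r0 fr] x1.
apply: ub_le_sup; last by exists x.
exists r => _ [y /= y1 <-].
by apply: le_trans (fr y) _; rewrite ler_piMr// ltW.
Qed.

Lemma ball_homogeneous f c : (forall x, unit_ball x -> `|f x| <= c) ->
  forall x, `|f x| <= c * `|x|.
Proof.
move=> fc x; have [->|x0] := eqVneq x 0; first by rewrite raddf0 !normr0 mulr0.
have := fc (`|x|^-1 *: x).
rewrite /unit_ball/= linearZ/= !normrM normrZ normfV normr_id mulVf ?normr_eq0//.
by rewrite ler_pdivrMl ?normr_gt0// mulrC; exact.
Qed.

(** Property (CS) for the traces on the ball of half-spaces given by functionals
of arbitrary norm.  The functionals obtained by freezing one factor of a
bilinear form need not have norm one; nonnegativity of the levels [a i], with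
the points [u i], makes the norms positive and the renormalized sets genuine
slices. *)
Lemma propertyCS_open_halfspaces (hV : propertyCS V) n (lam : 'I_n -> R)
    (f : 'I_n -> {scalar V}) (a : 'I_n -> R) (u : 'I_n -> V) :
  (forall i, 0 <= lam i <= 1) -> \sum_(i < n) lam i = 1 ->
  (forall i, continuous (f i : V -> R)) -> (forall i, 0 <= a i) ->
  (forall i, unit_ball (u i) /\ a i < f i (u i)) ->
  exists x : 'I_n -> V, (forall i, unit_ball (x i) /\ a i < f i (x i)) /\
    `|\sum_(i < n) lam i *: x i| = 1.
Proof.
move=> lam01 lam1 fcont a0 fu; pose N i := dual_norm (f i).
have aN i : a i < N i.
  have [u1 afu] := fu i; apply: lt_le_trans afu _.
  exact: le_trans (ler_norm _) (dual_norm_ge (fcont i) u1).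
have N0 i : 0 < N i by exact: le_lt_trans (a0 i) (aN i).
have /choice[g gE] (i : 'I_n) :
    exists h : {scalar V}, h =1 fun x => (N i)^-1 * f i x.
  apply: scalar_map => b x y.
  by rewrite linearD linearZ/= mulrDr mulrCA.
have g1 i : dual_sphere (g i).
  have gn x : unit_ball x -> `|g i x| <= 1.
    move=> x1; rewrite gE normrM gtr0_norm ?invr_gt0// ler_pdivrMl// mulr1.
    exact: dual_norm_ge.
  have gcont := scalar_bounded_continuous (ball_homogeneous gn).
  split=> //; apply/eqP; rewrite eq_le dual_norm_le//=.
  rewrite -(ler_pM2l (N0 i)) mulr1; apply: dual_norm_le => x x1.
  rewrite -ler_pdivrMl// -[(N i)^-1]gtr0_norm ?invr_gt0// -normrM -gE.
  exact: dual_norm_ge.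
pose S i := slice (g i) (1 - a i / N i).
have SE i x : S i x <-> unit_ball x /\ a i < f i x.
  by rewrite /S /slice/= gE subKr mulrC ltr_pM2l ?invr_gt0.
have [_ [[x [xS ->]] x1]] : minkowski_comb lam S `&` unit_sphere !=set0.
  apply: hV; exists n, lam, S; split=> // i; exists (g i), (1 - a i / N i).
  by split=> //; rewrite subr_gt0 ltr_pdivrMr// mul1r.
by exists x; split=> // i; apply/SE.
Qed.

(** The defects [lam i - lam i * f (x i)] are nonnegative and sum to zero.  The
conclusion keeps the factor [lam i] because nothing is known about [f (x i)]
when the weight vanishes. *)
Lemma extremal_at_mean f n (lam : 'I_n -> R) (x : 'I_n -> V) :
  (forall z, `|f z| <= `|z|) -> (forall i, unit_ball (x i)) ->
  (forall i, 0 <= lam i) -> \sum_(i < n) lam i = 1 ->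
  f (\sum_(i < n) lam i *: x i) = 1 -> forall i, lam i * f (x i) = lam i.
Proof.
move=> fle x1 lam0 lam1 fx i.
have le1 k : lam k * f (x k) <= lam k.
  by rewrite ler_piMr// (le_trans (ler_norm _))// (le_trans (fle _))// x1.
have : \sum_(k < n) (lam k - lam k * f (x k)) = 0.
  apply/eqP; rewrite sumrB lam1 subr_eq0 -[X in X == _]fx raddf_sum.
  by apply/eqP/eq_bigr => k _; rewrite /= scalarZ.
move/eqP; rewrite psumr_eq0 => [/allP/(_ i)|k _]; last by rewrite subr_ge0.
by rewrite mem_index_enum subr_eq0 => /(_ isT)/eqP.
Qed.

End NormedDual.

(** * Functionals on the projective tensor product *)

Section Tensor.
Context {R : realType} {X Y : normedModType R}.

Lemma tensor_functional (T : lmodType R) (tens : {bilinear X -> Y -> T})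
    (f : {scalar X}) (g : {scalar Y}) : is_tensor_product tens ->
  exists h : {scalar T}, forall x y, h (tens x y) = f x * g y.
Proof.
move=> tensP; pose b x y : R^o := f x * g y.
have bb : bilinear_for *:%R *:%R b.
  split=> [y c x x'|x c y y']; rewrite /b linearD linearZ/=.
    by rewrite mulrDl -mulrA.
  by rewrite mulrDr mulrCA.
pose bB := bilinear_isBilinear.Build R X Y R^o *:%R *:%R b bb.
pose B : {bilinear X -> Y -> R^o} := HB.pack b bB.
have [h hB] := (tensP _ B).1.
have [k kh] : exists k : {scalar T}, k =1 h.
  by apply: scalar_map => c u v; exact: linearP.
by exists k => x y; rewrite kh hB.
Qed.

Lemma projective_norm_has_lbound (T : lmodType R)
    (tens : {bilinear X -> Y -> T}) u :
  has_lbound [set r | exists (n : nat) (x : 'I_n -> X) (y : 'I_n -> Y),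
         u = \sum_(i < n) tens (x i) (y i) /\
         r = \sum_(i < n) `|x i| * `|y i|].
Proof.
exists 0 => _ [n [x [y [_ ->]]]].
by apply: sumr_ge0 => i _; rewrite mulr_ge0.
Qed.

Lemma projective_norm_tens (T : lmodType R) (tens : {bilinear X -> Y -> T}) x y :
  projective_norm tens (tens x y) <= `|x| * `|y|.
Proof.
apply: ge_inf; first exact: projective_norm_has_lbound.
by exists 1%N, (fun=> x), (fun=> y); rewrite !big_ord1.
Qed.

Lemma tens_scalarl (T : lmodType R) (tens : {bilinear X -> Y -> T})
    (h : {scalar T}) y : exists f : {scalar X}, forall x, f x = h (tens x y).
Proof. by apply: scalar_map => c x x'; rewrite linearPl linearP. Qed.

Lemma tens_scalarr (T : lmodType R) (tens : {bilinear X -> Y -> T})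
    (h : {scalar T}) x : exists g : {scalar Y}, forall y, g y = h (tens x y).
Proof. by apply: scalar_map => c y y'; rewrite linearPr linearP. Qed.

Lemma completion_tens_le (T : lmodType R) (tens : {bilinear X -> Y -> T})
    (Z : completeNormedModType R) (j : {linear T -> Z}) x y :
  is_completion (projective_norm tens) j ->
  `|j (tens x y)| <= `|x| * `|y|.
Proof. by move=> [-> _]; exact: projective_norm_tens. Qed.

(** A one-sided bound on the balls suffices because [tens (- x) y] is the
opposite of [tens x y]; homogeneity is then used in one factor at a time. *)
Lemma bounded_on_tens (T : lmodType R) (tens : {bilinear X -> Y -> T})
    (h : {scalar T}) c :
  (forall x y, unit_ball x -> unit_ball y -> h (tens x y) <= c) ->
  forall x y, `|h (tens x y)| <= c * (`|x| * `|y|).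
Proof.
move=> hc x y.
have habs x' y' : unit_ball x' -> unit_ball y' -> `|h (tens x' y')| <= c.
  move=> x1 y1; rewrite ler_norml hc// andbT lerNl -raddfN -linearNl.
  by apply: hc => //; rewrite /unit_ball/= normrN.
have [g gE] := tens_scalarr tens h x.
rewrite mulrA -gE; apply: ball_homogeneous => y' y1; rewrite gE.
have [f fE] := tens_scalarl tens h y'.
by rewrite -fE; apply: ball_homogeneous => x' x1; rewrite fE; exact: habs.
Qed.

(** The half of the duality between the projective norm and bounded bilinear
forms that holds representation by representation: the triangle inequality
applies to every way of writing the argument as a sum of elementary tensors, and
the projective norm is the infimum over these. *)
Lemma le_projective_norm (T : lmodType R) (tens : {bilinear X -> Y -> T})
    (h : {scalar T}) c n (x : 'I_n -> X) (y : 'I_n -> Y) : 0 <= c ->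
  (forall x y, `|h (tens x y)| <= c * (`|x| * `|y|)) ->
  `|h (\sum_(i < n) tens (x i) (y i))|
    <= c * projective_norm tens (\sum_(i < n) tens (x i) (y i)).
Proof.
move=> c_ge0 hb; have [c0|c_neq0] := eqVneq c 0.
  rewrite c0 mul0r raddf_sum (le_trans (ler_norm_sum _ _ _))//.
  by apply: sumr_le0 => i _; rewrite (le_trans (hb _ _))// c0 mul0r.
have c0 : 0 < c by rewrite lt_neqAle eq_sym c_neq0.
rewrite -ler_pdivrMl//; apply: lb_le_inf; first by eexists; exists n, x, y.
move=> _ [m [x' [y' [-> ->]]]]; rewrite ler_pdivrMl// raddf_sum mulr_sumr.
apply: le_trans (ler_norm_sum _ _ _) _.
by apply: ler_sum => i _; exact: hb.
Qed.

(** The bound passes from elementary tensors to the algebraic tensor product by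
definition of the projective norm, and to the completion by density. *)
Lemma completion_scalar_le (T : lmodType R) (tens : {bilinear X -> Y -> T})
    (Z : completeNormedModType R) (j : {linear T -> Z}) (G : {scalar Z}) c :
  is_completion (projective_norm tens) j -> continuous (G : Z -> R) ->
  0 <= c -> (forall x y, `|G (j (tens x y))| <= c * (`|x| * `|y|)) ->
  forall z, `|G z| <= c * `|z|.
Proof.
move=> [jp jdense] Gcont c0 Gb z.
have Gj u : `|G (j u)| <= c * `|j u|.
  have [[n [x [y ->]]]|nrep] :=
    pselect (exists n (x : 'I_n -> X) (y : 'I_n -> Y),
      u = \sum_(i < n) tens (x i) (y i)).
    by rewrite jp; exact: (@le_projective_norm _ tens (G \o j)).
  (* Without a representation of [u], the infimum that defines the projective
     norm is over the empty set, hence is 0 and forces [j u = 0]. *)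
  have /eqP : `|j u| = 0.
    rewrite jp -(@inf0 R); congr inf; rewrite -subset0 => r [n [x [y [uE _]]]].
    by apply: nrep; exists n, x, y.
  by rewrite normr_eq0 => /eqP ->; rewrite raddf0 !normr0 mulr0.
rewrite leNgt; apply/negP => cG.
(* The set where the bound fails is open, so it would meet the dense range. *)
have [||w [/= w_gt [u _ juw]]] := jdense [set z | 0 < `|G z| - c * `|z|].
- by exists z; rewrite /= subr_gt0.
- have cont : continuous (fun z => `|G z| - c * `|z|).
    move=> w; apply: cvgB; first by apply: cvg_norm; exact: Gcont.
    by apply: cvgMr; exact: norm_continuous.
  apply: (@open_comp _ R (fun z => `|G z| - c * `|z|) [set t | 0 < t]) => [w _|].
    exact: cont.
  exact: open_gt.
- by move: w_gt; rewrite -juw subr_gt0 ltNge Gj.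
Qed.

(** Otherwise [G] would be bounded by [c] on elementary tensors, hence on the
whole ball, against [c < dual_norm G]. *)
Lemma elementary_tensor_in_slice (T : lmodType R)
    (tens : {bilinear X -> Y -> T})
    (Z : completeNormedModType R) (j : {linear T -> Z}) (G : {scalar Z}) c :
  is_completion (projective_norm tens) j -> continuous (G : Z -> R) ->
  0 <= c -> c < dual_norm G ->
  exists x y, [/\ unit_ball x, unit_ball y & c < G (j (tens x y))].
Proof.
move=> jP Gcont c0 cG; apply: contrapT => noxy.
suff : dual_norm G <= c by rewrite leNgt cG.
apply: dual_norm_le => z z1.
apply: (@le_trans _ _ (c * `|z|)); last by rewrite ler_piMr.
apply: (completion_scalar_le jP) => //.
apply: (@bounded_on_tens _ tens (G \o j)) => x y x1 y1 /=.
by rewrite leNgt; apply/negP => cGxy; apply: noxy; exists x, y.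
Qed.

(** The lower bound is witnessed by [f (x) g], where [f] and [g] norm the two
means; the diagonal sum is evaluated exactly because [f] and [g] are [1] at all
points that carry weight. *)
Lemma norm_convex_tens_eq1 (T : lmodType R) (tens : {bilinear X -> Y -> T})
    (Z : completeNormedModType R) (j : {linear T -> Z}) n (lam : 'I_n -> R)
    (x : 'I_n -> X) (y : 'I_n -> Y) :
  is_tensor_product tens -> is_completion (projective_norm tens) j ->
  (forall i, 0 <= lam i) -> \sum_(i < n) lam i = 1 ->
  (forall i, unit_ball (x i)) -> (forall i, unit_ball (y i)) ->
  `|\sum_(i < n) lam i *: x i| = 1 -> `|\sum_(i < n) lam i *: y i| = 1 ->
  `|\sum_(i < n) lam i *: j (tens (x i) (y i))| = 1.
Proof.
move=> tensP jP lam0 lam1 x1 y1 sx sy.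
have [f [fle fx]] := norming_functional (\sum_(i < n) lam i *: x i).
have [g [gle gy]] := norming_functional (\sum_(i < n) lam i *: y i).
have fx1 := extremal_at_mean fle x1 lam0 lam1 (etrans fx sx).
have gy1 := extremal_at_mean gle y1 lam0 lam1 (etrans gy sy).
have [h hE] := tensor_functional f g tensP.
have uE : \sum_(i < n) lam i *: j (tens (x i) (y i)) =
    j (\sum_(i < n) tens (lam i *: x i) (y i)).
  by rewrite raddf_sum; apply: eq_bigr => i _; rewrite linearZl_LR /= linearZ.
have hu : h (\sum_(i < n) tens (lam i *: x i) (y i)) = 1.
  rewrite raddf_sum -lam1; apply: eq_bigr => i _.
  by rewrite /= hE linearZ/= fx1 gy1.
apply/eqP; rewrite eq_le; apply/andP; split.
  rewrite -[leRHS]lam1 (le_trans (ler_norm_sum _ _ _))//.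
  apply: ler_sum => i _; rewrite normrZ ger0_norm// ler_piMr//.
  rewrite (le_trans (completion_tens_le _ _ jP))// mulr_ile1//; first exact: x1.
  exact: y1.
rewrite uE jP.1 -[leLHS]normr1 -hu -[leRHS]mul1r.
apply: le_projective_norm => // v w; rewrite hE normrM mul1r.
exact: ler_pM.
Qed.

End Tensor.

(** * Property (CS) of the projective tensor product *)

Theorem proposition3p6 (R : realType) (X Y XY : completeNormedModType R)
    (hX : propertyCS X) (hY : propertyCS Y)
    (hXY : is_projective_tensor_product X Y XY) :
  propertyCS XY.
Proof.
have [T [tens [j [tensP jP]]]] := hXY.
move=> _ [n [lam [S [lam01 lam1 /choice[G /choice[alpha SG]] ->]]]].
have Gcont i : continuous (G i : XY -> R) by have [[]] := SG i.
have G1 i : dual_norm (G i) = 1 by have [[]] := SG i.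
have Gle i z : `|G i z| <= `|z|.
  rewrite -[leRHS]mul1r; apply: ball_homogeneous => z' z'1.
  by rewrite -(G1 i) dual_norm_ge.
(* Raising the levels to be nonnegative only shrinks the slices, and they stay
   below the norm of [G i]. *)
pose a i := Num.max 0 (1 - alpha i).
have a0 i : 0 <= a i by rewrite le_max lexx.
have a1 i : a i < 1 by rewrite gt_max ltr01 ltrBlDr ltrDl; have [] := SG i.
have /choice[u /choice[v uv]] (i : 'I_n) : exists x y,
    [/\ unit_ball x, unit_ball y & a i < G i (j (tens x y))].
  by apply: (elementary_tensor_in_slice jP) => //; rewrite G1.
have Gtens i x y : unit_ball y -> `|G i (j (tens x y))| <= `|x|.
  move=> y1; apply: le_trans (Gle _ _) _.
  by apply: le_trans (completion_tens_le _ _ jP) _; rewrite ler_piMr.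
have Gtens' i x y : unit_ball x -> `|G i (j (tens x y))| <= `|y|.
  move=> x1; apply: le_trans (Gle _ _) _.
  by apply: le_trans (completion_tens_le _ _ jP) _; rewrite ler_piMl.
have /choice[f fE] i := tens_scalarl tens (G i \o j) (v i).
have [|i|x [xS x1]] :=
  propertyCS_open_halfspaces hX (f := f) lam01 lam1 _ a0 (u := u).
- move=> i; apply: (@scalar_bounded_continuous _ _ _ 1) => x.
  by rewrite fE mul1r Gtens//; have [] := uv i.
- by have [u1 v1 Guv] := uv i; rewrite fE.
have /choice[g gE] i := tens_scalarr tens (G i \o j) (x i).
have [|i|y [yS y1]] :=
  propertyCS_open_halfspaces hY (f := g) lam01 lam1 _ a0 (u := v).
- move=> i; apply: (@scalar_bounded_continuous _ _ _ 1) => y.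
  by rewrite gE mul1r Gtens'//; have [] := xS i.
- by have [_ v1 _] := uv i; have [_] := xS i; rewrite gE fE.
exists (\sum_(i < n) lam i *: j (tens (x i) (y i))); split.
  exists (fun i => j (tens (x i) (y i))); split=> // i.
  have [_ _ ->] := SG i; split.
    apply: le_trans (completion_tens_le _ _ jP) _.
    by rewrite mulr_ile1//; [have [] := xS i|have [] := yS i].
  have [_] := yS i; rewrite gE/=; apply: le_lt_trans.
  by rewrite le_max lexx orbT.
apply: norm_convex_tens_eq1 => //.
- by move=> i; have /andP[] := lam01 i.
- by move=> i; have [] := xS i.
- by move=> i; have [] := yS i.
Qed.
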